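(* The functors $$v_{(-)}\colon\mathbf{FP}_+\to\mathbf{Ab}/\mathbb{Z}_2,\quad Q\mapsto v_Q\qquad\text{and}\qquad v'_{(-)}\colon\mathbf{FP}_-\to\mathbb{Z}_2/\mathbf{Ab},\quad Q\mapsto v'_Q$$ are equivalences of categories.
   Context: $\mathbb{Z}_2=\mathbb{Z}/2$; all abelian groups are finitely generated and $\mathbf{Ab}$ is the category of finitely generated abelian groups. A form parameter is a triple $Q=(Q_e,h,p)$ with $Q_e$ an abelian group and homomorphisms $h\colon Q_e\to\mathbb{Z}$, $p\colon\mathbb{Z}\to Q_e$ such that $hph=2h$, $php=2p$. Its symmetry $\epsilon_Q\in\{\pm1\}$ is defined by $hp=(1+\epsilon_Q)\mathrm{Id}_{\mathbb{Z}}$; $Q$ is symmetric if $\epsilon_Q=1$ and anti-symmetric if $\epsilon_Q=-1$. A morphism $\alpha\colon P\to Q$ is a homomorphism $\alpha\colon P_e\to Q_e$ with $h_P=h_Q\circ\alpha$ and $p_Q=\alpha\circ p_P$. $\mathbf{FP}_+$ and $\mathbf{FP}_-$ are the categories of symmetric and anti-symmetric form parameters. The linearisation of $Q$ is $SQ:=Q_e/p(\mathbb{Z})$; a morphism $\alpha\colon P\to Q$ induces $S\alpha\colon SP\to SQ$. For $Q$ symmetric, $v_Q\colon SQ\to\mathbb{Z}_2$ is $[q]\mapsto h(q)\bmod2$. For $Q$ anti-symmetric, $v'_Q\colon\mathbb{Z}_2\to Q_e$ is $[n]\mapsto p(n)$. $\mathbf{Ab}/\mathbb{Z}_2$ is the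 slice category: objects are homomorphisms $v\colon A\to\mathbb{Z}_2$, $A\in\mathbf{Ab}$; morphisms $(v_1\colon A_1\to\mathbb{Z}_2)\to(v_2\colon A_2\to\mathbb{Z}_2)$ are homomorphisms $f\colon A_1\to A_2$ with $v_2f=v_1$. $\mathbb{Z}_2/\mathbf{Ab}$ is the coslice category: objects are homomorphisms $v'\colon\mathbb{Z}_2\to A$; morphisms are homomorphisms $f\colon A_1\to A_2$ with $fv'_1=v'_2$. On morphisms, $v_{(-)}$ sends $\alpha$ to $S\alpha$ and $v'_{(-)}$ sends $\alpha$ to $\alpha\colon P_e\to Q_e$. *)

(* Defs.v *)
From HB Require Import structures.
From mathcomp Require Import all_boot all_order all_algebra.
From mathcomp Require Import generic_quotient ring_quotient.
From mathcomp Require Import boolp.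

Set Implicit Arguments.
Unset Strict Implicit.
Unset Printing Implicit Defensive.

Import GRing.Theory.
Local Open Scope ring_scope.
Local Open Scope quotient_scope.

Local Obligation Tactic := idtac.

Record category := Category {
  obj :> Type;
  hom : obj -> obj -> Type;
  ident : forall a, hom a a;
  compose : forall a b c, hom b c -> hom a b -> hom a c;
  compose_idl : forall a b (f : hom a b), compose (ident b) f = f;
  compose_idr : forall a b (f : hom a b), compose f (ident a) = f;
  composeA : forall a b c d (f : hom a b) (g : hom b c) (k : hom c d),
    compose k (compose g f) = compose (compose k g) f
}.

Record functor (C D : category) := Functor {
  fobj :> C -> D;
  fmap : forall a b : C, hom a b -> hom (fobj a) (fobj b);
  fmap_id : forall a : C, fmap (ident a) = ident (fobj a);
  fmap_compose : forall (a b c : C) (g : hom b c) (f : hom a b),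
    fmap (compose g f) = compose (fmap g) (fmap f)
}.

Program Definition id_functor (C : category) : functor C C :=
  @Functor C C id (fun _ _ f => f) _ _.
Solve All Obligations with by [].

Program Definition comp_functor (C D E : category)
    (G : functor D E) (F : functor C D) : functor C E :=
  @Functor C E (fun a => G (F a)) (fun _ _ f => fmap G (fmap F f)) _ _.
Next Obligation. by move=> C D E G F a /=; rewrite !fmap_id. Qed.
Next Obligation. by move=> C D E G F a b c g f /=; rewrite !fmap_compose. Qed.

Definition is_iso (C : category) (a b : C) (f : hom a b) : Prop :=
  exists g : hom b a, compose g f = ident a /\ compose f g = ident b.

Definition natural (C D : category) (F G : functor C D)
    (eta : forall a : C, hom (F a) (G a)) : Prop :=
  forall (a b : C) (f : hom a b),
    compose (eta b) (fmap F f) = compose (fmap G f) (eta a).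

Definition naturally_isomorphic (C D : category) (F G : functor C D) : Prop :=
  exists eta : forall a : C, hom (F a) (G a),
    natural eta /\ forall a : C, is_iso (eta a).

Definition is_equivalence (C D : category) (F : functor C D) : Prop :=
  exists G : functor D C,
    naturally_isomorphic (comp_functor G F) (id_functor C) /\
    naturally_isomorphic (comp_functor F G) (id_functor D).

Program Definition full_subcategory (C : category) (P : C -> Prop) : category :=
  @Category {a : C | P a} (fun a b => hom (proj1_sig a) (proj1_sig b))
    (fun a => ident (proj1_sig a)) (fun a b c g f => compose g f) _ _ _.
Next Obligation. by move=> *; exact: compose_idl. Qed.
Next Obligation. by move=> *; exact: compose_idr. Qed.
Next Obligation. by move=> *; exact: composeA. Qed.

Program Definition slice (C : category) (X : C) : category :=
  @Category {a : C & hom a X}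
    (fun v w => {f : hom (projT1 v) (projT1 w) |
                   compose (projT2 w) f = projT2 v})
    (fun v => exist _ (ident (projT1 v)) _)
    (fun u v w g f => exist _ (compose (proj1_sig g) (proj1_sig f)) _) _ _ _.
Next Obligation. by move=> C X v; exact: compose_idr. Qed.
Next Obligation. by move=> C X u v w [g gE] [f fE] /=; rewrite composeA gE. Qed.
Next Obligation. by move=> C X u v [f fE]; apply: eq_exist; exact: compose_idl. Qed.
Next Obligation. by move=> C X u v [f fE]; apply: eq_exist; exact: compose_idr. Qed.
Next Obligation. by move=> C X s t u v [f ?] [g ?] [k ?]; apply: eq_exist; exact: composeA. Qed.

Program Definition coslice (C : category) (X : C) : category :=
  @Category {a : C & hom X a}
    (fun v w => {f : hom (projT1 v) (projT1 w) |
                   compose f (projT2 v) = projT2 w})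
    (fun v => exist _ (ident (projT1 v)) _)
    (fun u v w g f => exist _ (compose (proj1_sig g) (proj1_sig f)) _) _ _ _.
Next Obligation. by move=> C X v; exact: compose_idl. Qed.
Next Obligation. by move=> C X u v w [g gE] [f fE] /=; rewrite -composeA fE. Qed.
Next Obligation. by move=> C X u v [f fE]; apply: eq_exist; exact: compose_idl. Qed.
Next Obligation. by move=> C X u v [f fE]; apply: eq_exist; exact: compose_idr. Qed.
Next Obligation. by move=> C X s t u v [f ?] [g ?] [k ?]; apply: eq_exist; exact: composeA. Qed.

Definition finitely_generated (A : zmodType) : Prop :=
  exists (n : nat) (g : 'I_n -> A), forall a : A,
    exists c : 'I_n -> int, a = \sum_(i < n) g i *~ c i.

Record fgab := FGAb {
  fgab_sort :> zmodType;
  fgabP : finitely_generated fgab_sort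
}.

Lemma additive_eq (A B : zmodType) (f g : {additive A -> B}) : f =1 g -> f = g.
Proof.
case: f => f [[[f0 fD]]]; case: g => g [[[g0 gD]]] /= /funext fg.
move: f0 fD; rewrite /= in fg; rewrite fg => f0 fD.
by rewrite (Prop_irrelevance f0 g0) (Prop_irrelevance fD gD).
Qed.

Program Definition Ab : category :=
  @Category fgab (fun A B => {additive A -> B})
    (fun A => idfun : {additive A -> A})
    (fun A B C g f => g \o f : {additive A -> C}) _ _ _.
Next Obligation. by move=> *; exact: additive_eq. Qed.
Next Obligation. by move=> *; exact: additive_eq. Qed.
Next Obligation. by move=> *; exact: additive_eq. Qed.

Lemma Z2_finitely_generated : finitely_generated 'Z_2.
Proof.
exists 1%N, (fun=> 1) => a; exists (fun=> (a : nat)%:Z).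
by rewrite big_ord1 -pmulrn natr_Zp.
Qed.

Definition Z2 : Ab := FGAb Z2_finitely_generated.

Record form_parameter := FormParameter {
  Qe : fgab;
  fp_h : {additive Qe -> int};
  fp_p : {additive int -> Qe};
  fp_hph : forall q : Qe, fp_h (fp_p (fp_h q)) = fp_h q *+ 2;
  fp_php : forall n : int, fp_p (fp_h (fp_p n)) = fp_p n *+ 2
}.

(* The integer [epsilon] with [h p = (1 + epsilon) Id]; see [symmetryP] and
   [symmetry_pm1]. *)
Definition symmetry (Q : form_parameter) : int := fp_h Q (fp_p Q 1) - 1.

Lemma symmetryP (Q : form_parameter) (n : int) :
  fp_h Q (fp_p Q n) = (1 + symmetry Q) * n.
Proof.
by rewrite /symmetry addrC subrK -[n in LHS]intz !raddfMz -mulrzr intz.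
Qed.

Lemma symmetry_pm1 (Q : form_parameter) : symmetry Q = 1 \/ symmetry Q = -1.
Proof.
have := fp_hph (fp_p Q 1); rewrite !symmetryP mulr1 -mulr_natr => /mulfI.
have [/eqP e _|nz /(_ isT)/eqP e] := eqVneq (1 + symmetry Q) 0.
  by right; apply/eqP; rewrite -addr_eq0 addrC.
by left; apply: (addrI 1); apply/eqP.
Qed.

Definition symmetric_fp (Q : form_parameter) : Prop := symmetry Q = 1.
Definition antisymmetric_fp (Q : form_parameter) : Prop := symmetry Q = -1.

Record fp_morphism (P Q : form_parameter) := FPMorphism {
  fp_map :> {additive Qe P -> Qe Q};
  fp_map_h : forall x : Qe P, fp_h P x = fp_h Q (fp_map x);
  fp_map_p : forall n : int, fp_p Q n = fp_map (fp_p P n)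
}.

Lemma fp_morphism_eq (P Q : form_parameter) (f g : fp_morphism P Q) :
  (f : Qe P -> Qe Q) =1 g -> f = g.
Proof.
case: f => f fh fp; case: g => g gh gp /= /additive_eq fg.
case: g / fg gh gp => gh gp.
by rewrite (Prop_irrelevance fh gh) (Prop_irrelevance fp gp).
Qed.

Program Definition fp_id (P : form_parameter) : fp_morphism P P :=
  @FPMorphism P P idfun _ _.
Solve All Obligations with by [].

Program Definition fp_comp (P Q R : form_parameter)
    (g : fp_morphism Q R) (f : fp_morphism P Q) : fp_morphism P R :=
  @FPMorphism P R (g \o f : {additive Qe P -> Qe R}) _ _.
Next Obligation. by move=> P Q R g f x /=; rewrite -!fp_map_h. Qed.
Next Obligation. by move=> P Q R g f n /=; rewrite -!fp_map_p. Qed.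

Program Definition FP : category :=
  @Category form_parameter fp_morphism fp_id fp_comp _ _ _.
Next Obligation. by move=> *; exact: fp_morphism_eq. Qed.
Next Obligation. by move=> *; exact: fp_morphism_eq. Qed.
Next Obligation. by move=> *; exact: fp_morphism_eq. Qed.

Definition FP_plus : category := @full_subcategory FP symmetric_fp.
Definition FP_minus : category := @full_subcategory FP antisymmetric_fp.

Definition im_p (Q : form_parameter) (q : Qe Q) : bool :=
  `[< exists n : int, q = fp_p Q n >].

Lemma im_p_zmod_closed (Q : form_parameter) : zmod_closed (@im_p Q).
Proof.
split; first by apply/asboolP; exists 0; rewrite raddf0.
move=> x y /asboolP[m ->] /asboolP[n ->]; apply/asboolP.
by exists (m - n); rewrite raddfB.
Qed.

HB.instance Definition _ (Q : form_parameter) :=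
  GRing.isZmodClosed.Build (Qe Q) (@im_p Q) (@im_p_zmod_closed Q).

Definition im_p_closed (Q : form_parameter) : zmodClosed (Qe Q) :=
  GRing.ZmodClosed.clone (Qe Q) (@im_p Q) _.

Definition linearisation_quot (Q : form_parameter) : zmodType :=
  Quotient.quot (im_p_closed Q).

Definition lin_pi (Q : form_parameter) : {additive Qe Q -> linearisation_quot Q} :=
  \pi_(Quotient.quot (im_p_closed Q)).

Lemma lin_pi_surj (Q : form_parameter) (x : linearisation_quot Q) :
  lin_pi Q (repr x) = x.
Proof. exact: reprK. Qed.

Lemma lin_pi_eq (Q : form_parameter) (x y : Qe Q) :
  lin_pi Q x = lin_pi Q y <-> exists n : int, x - y = fp_p Q n.
Proof.
split; first by move/eqP; rewrite -Quotient.idealrBE => /asboolP.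
by move=> ?; apply/eqP; rewrite -Quotient.idealrBE; apply/asboolP.
Qed.

Lemma linearisation_fg (Q : form_parameter) :
  finitely_generated (linearisation_quot Q).
Proof.
have [n [g gP]] := fgabP (Qe Q).
exists n, (fun i => lin_pi Q (g i)) => x; have [c cE] := gP (repr x).
exists c; rewrite -[LHS]lin_pi_surj cE raddf_sum.
by apply: eq_bigr => i _; rewrite raddfMz.
Qed.

Definition linearisation (Q : form_parameter) : fgab := FGAb (linearisation_fg Q).

(* Homomorphisms out of [Qe Q] that kill the image of [p] factor through
   the linearisation. *)
Section LinLift.
Variables (Q : form_parameter) (B : zmodType) (f : {additive Qe Q -> B}).
Hypothesis f_p : forall n : int, f (fp_p Q n) = 0.

Definition lin_lift_fun (x : linearisation Q) : B := f (repr x).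

Lemma lin_lift_fun_pi (q : Qe Q) : lin_lift_fun (lin_pi Q q) = f q.
Proof.
have /lin_pi_eq[n e] : lin_pi Q (repr (lin_pi Q q)) = lin_pi Q q.
  exact: lin_pi_surj.
by apply/eqP; rewrite -subr_eq0 /lin_lift_fun -raddfB e f_p.
Qed.

Lemma lin_lift_additive : zmod_morphism lin_lift_fun.
Proof.
move=> x y; rewrite -[x]lin_pi_surj -[y]lin_pi_surj -raddfB.
by rewrite !lin_lift_fun_pi raddfB.
Qed.

HB.instance Definition _ :=
  GRing.isZmodMorphism.Build (linearisation Q) B lin_lift_fun lin_lift_additive.

Definition lin_lift : {additive linearisation Q -> B} := lin_lift_fun.

Lemma lin_lift_pi (q : Qe Q) : lin_lift (lin_pi Q q) = f q.
Proof. exact: lin_lift_fun_pi. Qed.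
End LinLift.

Lemma lin_map_p (P Q : form_parameter) (alpha : fp_morphism P Q) (n : int) :
  (lin_pi Q \o alpha) (fp_p P n) = 0.
Proof.
rewrite /= -fp_map_p -[RHS](raddf0 (lin_pi Q)); apply/lin_pi_eq.
by exists n; rewrite subr0.
Qed.

Definition lin_map (P Q : form_parameter) (alpha : fp_morphism P Q) :
    {additive linearisation P -> linearisation Q} :=
  lin_lift (lin_map_p alpha).

Lemma lin_map_pi (P Q : form_parameter) (alpha : fp_morphism P Q) (x : Qe P) :
  lin_map alpha (lin_pi P x) = lin_pi Q (alpha x).
Proof. exact: lin_lift_pi. Qed.

Definition mod2 : {additive int -> 'Z_2} := (intmul 1 : int -> 'Z_2).

Lemma v_p (Q : form_parameter) (sQ : symmetric_fp Q) (n : int) :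
  (mod2 \o fp_h Q) (fp_p Q n) = 0.
Proof.
have two0 : (1 + 1)%:~R = 0 :> 'Z_2 by exact/val_inj.
by rewrite /= symmetryP sQ /mod2 /= rmorphM /= two0 mul0r.
Qed.

Definition v_map (Q : form_parameter) (sQ : symmetric_fp Q) :
    {additive linearisation Q -> 'Z_2} :=
  lin_lift (v_p sQ).

Lemma v_map_pi (Q : form_parameter) (sQ : symmetric_fp Q) (q : Qe Q) :
  v_map sQ (lin_pi Q q) = (fp_h Q q)%:~R.
Proof. exact: lin_lift_pi. Qed.

Definition v_obj (Q : FP_plus) : slice Z2 :=
  existT (fun A : Ab => hom A Z2) (linearisation (proj1_sig Q) : Ab)
    (v_map (proj2_sig Q)).

Lemma v_mor_comm (P Q : FP_plus) (alpha : hom P Q) :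
  compose (projT2 (v_obj Q)) (lin_map alpha : hom (projT1 (v_obj P)) _)
    = projT2 (v_obj P).
Proof.
apply: additive_eq => x.
change (v_map (proj2_sig Q) (lin_map alpha x) = v_map (proj2_sig P) x).
by rewrite -[x]lin_pi_surj lin_map_pi !v_map_pi -fp_map_h.
Qed.

Definition v_mor (P Q : FP_plus) (alpha : hom P Q) : hom (v_obj P) (v_obj Q) :=
  exist _ (lin_map alpha) (v_mor_comm alpha).

Program Definition v_functor : functor FP_plus (slice Z2) :=
  @Functor _ _ v_obj v_mor _ _.
Next Obligation.
move=> Q; apply: eq_exist; apply: additive_eq => x.
change (lin_map (fp_id (proj1_sig Q)) x = x).
by rewrite -[x]lin_pi_surj lin_map_pi.
Qed.
Next Obligation.
move=> P Q R g f; apply: eq_exist; apply: additive_eq => x.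
change (lin_map (fp_comp g f) x = lin_map g (lin_map f x)).
by rewrite -[x]lin_pi_surj !lin_map_pi.
Qed.

Section V'.
Variables (Q : form_parameter) (aQ : antisymmetric_fp Q).

(* [x] is represented by its canonical lift in {0, 1}; [v'_mapE] below shows that
   the value does not depend on the lift. *)
Definition v'_fun (x : 'Z_2) : Qe Q := fp_p Q (x : nat)%:Z.

Lemma v'_funE (n : int) : v'_fun n%:~R = fp_p Q n.
Proof.
have p2 k : fp_p Q (k *+ 2) = 0.
  by rewrite raddfMn /= -fp_php symmetryP aQ subrr mul0r raddf0.
have two0 : 2%:R = 0 :> 'Z_2 by exact/val_inj.
have [k [b ->]] : exists (k : int) (b : bool), n = k *+ 2 + (b : nat)%:Z.
  exists (n %/ 2)%Z, (n %% 2 == 1)%Z; rewrite [LHS](divz_eq n 2) mulr_natr.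
  congr (_ + _); have := ltz_pmod n (isT : 0 < 2 :> int).
  by have := modz_ge0 n (isT : 2 != 0 :> int); case: (n %% 2)%Z => [[|[|]]|].
rewrite (raddfD (fp_p Q)) p2 add0r rmorphD /= -mulr_natr rmorphM /=.
rewrite -[2%:~R]/(2%:R) two0 mulr0 add0r.
by case: b.
Qed.

Lemma v'_additive : zmod_morphism v'_fun.
Proof.
have surj (x : 'Z_2) : ((x : nat)%:Z)%:~R = x by rewrite -pmulrn natr_Zp.
move=> x y; rewrite -[x]surj -[y]surj -rmorphB.
by rewrite !v'_funE raddfB.
Qed.

HB.instance Definition _ :=
  GRing.isZmodMorphism.Build 'Z_2 (Qe Q) v'_fun v'_additive.

Definition v'_map : {additive 'Z_2 -> Qe Q} := v'_fun.

Lemma v'_mapE (n : int) : v'_map n%:~R = fp_p Q n.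
Proof. exact: v'_funE. Qed.
End V'.

Definition v'_obj (Q : FP_minus) : coslice Z2 :=
  existT (fun A : Ab => hom Z2 A) (Qe (proj1_sig Q) : Ab)
    (v'_map (proj2_sig Q)).

Lemma v'_mor_comm (P Q : FP_minus) (alpha : hom P Q) :
  compose (fp_map alpha : hom (_ : Ab) _) (projT2 (v'_obj P))
    = projT2 (v'_obj Q).
Proof. by apply: additive_eq => x; rewrite /= /v'_fun -fp_map_p. Qed.

Definition v'_mor (P Q : FP_minus) (alpha : hom P Q) :
    hom (v'_obj P) (v'_obj Q) :=
  exist _ (fp_map alpha) (v'_mor_comm alpha).

Program Definition v'_functor : functor FP_minus (coslice Z2) :=
  @Functor _ _ v'_obj v'_mor _ _.
Next Obligation. by move=> Q; apply: eq_exist; exact: additive_eq. Qed.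
Next Obligation. by move=> P Q R g f; apply: eq_exist; exact: additive_eq. Qed.

(* Main.v *)
(** A symmetric form parameter is recovered from its linearisation as a
    pullback: [q |-> ([q], h q)] identifies [Q_e] with the pairs [(y, n)] in
    [SQ * Z] such that [v_Q y = n mod 2].  Indeed [q = p n] and [h q = 0] give
    [2 n = 0], while if [h q = n mod 2] then [q] can be corrected by a multiple
    of [p 1] without changing its class.  For an anti-symmetric [Q],
    [2 h = h p h = 0] and [2 p = p h p = 0], so [h = 0] and [p] factors through
    [Z/2]: the form parameter is just the map [Z/2 -> Q_e]. *)
From HB Require Import structures.
From mathcomp Require Import all_boot all_order all_algebra.
From mathcomp Require Import boolp.
Require Import Defs.

Set Implicit Arguments.
Unset Strict Implicit.
Unset Printing Implicit Defensive.

Import GRing.Theory Num.Theory.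
Local Open Scope ring_scope.

(** * Equivalences from full faithfulness and objectwise counits *)

Section FullyFaithful.
Variables (C D : category) (F : functor C D).
Hypothesis F_full : forall (a b : C) (g : hom (F a) (F b)),
  exists f : hom a b, fmap F f = g.
Hypothesis F_faithful : forall (a b : C) (f g : hom a b),
  fmap F f = fmap F g -> f = g.

Lemma fully_faithful_reflects_iso (a b : C) (f : hom a b) :
  is_iso (fmap F f) -> is_iso f.
Proof.
move=> [g [gf fg]]; have [k kE] := F_full g.
by exists k; split; apply: F_faithful; rewrite fmap_compose kE fmap_id.
Qed.

(** [G0] need only be given on objects: on morphisms the inverse is the preimage under [F] of
    conjugation by the counit, so functoriality follows from faithfulness and the counit is natural
    by construction. *)
Lemma fully_faithful_equivalence (G0 : D -> C)
    (counit : forall d : D, hom (F (G0 d)) d) :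
  (forall d, is_iso (counit d)) -> is_equivalence F.
Proof.
move=> counit_iso.
pose inv d := proj1_sig (cid (counit_iso d)).
have invK d : compose (inv d) (counit d) = ident _ := (proj2_sig (cid (counit_iso d))).1.
have counitK d : compose (counit d) (inv d) = ident _ :=
  (proj2_sig (cid (counit_iso d))).2.
pose lift a b g := proj1_sig (cid (@F_full a b g)).
have liftK a b g : fmap F (@lift a b g) = g := proj2_sig (cid (@F_full a b g)).
pose G1 d e (k : hom d e) : hom (G0 d) (G0 e) :=
  lift _ _ (compose (inv e) (compose k (counit d))).
have G1_id d : G1 d d (ident d) = ident (G0 d).
  by apply: F_faithful; rewrite liftK fmap_id compose_idl invK.
have G1_compose a b c g f : G1 a c (compose g f) = compose (G1 b c g) (G1 a b f).
  apply: F_faithful; rewrite fmap_compose !liftK -!composeA; congr compose.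
  by rewrite [in RHS](composeA _ (inv b) (counit b)) counitK compose_idl.
exists (Functor G1_id G1_compose); split.
(* The other isomorphism, at [a], is the preimage under [F] of the counit at [F a]. *)
- exists (fun a => lift _ _ (counit (F a))); split=> [a b f|a].
    apply: F_faithful; rewrite /= !fmap_compose !liftK composeA counitK.
    by rewrite compose_idl.
  by apply: fully_faithful_reflects_iso; rewrite liftK; exact: counit_iso.
- exists counit; split=> [a b f|//].
  by rewrite /= liftK composeA counitK compose_idl.
Qed.
End FullyFaithful.

(** * Isomorphisms in slices, coslices and abelian groups *)

Lemma slice_iso (C : category) (X : C) (v w : slice X) (f : hom v w) :
  is_iso (proj1_sig f) -> is_iso f.
Proof.
move=> [g [gf fg]].
have gv : compose (projT2 v) g = projT2 w.
  by rewrite -(proj2_sig f) -composeA fg compose_idr.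
by exists (exist _ g gv); split; apply: eq_exist.
Qed.

Lemma coslice_iso (C : category) (X : C) (v w : coslice X) (f : hom v w) :
  is_iso (proj1_sig f) -> is_iso f.
Proof.
move=> [g [gf fg]].
have gv : compose g (projT2 w) = projT2 v.
  by rewrite -(proj2_sig f) composeA gf compose_idl.
by exists (exist _ g gv); split; apply: eq_exist.
Qed.

(** The inverse of an additive bijection is additive, so [g] may be a bare function; this suits
    [pullback_inv], which is built from non-additive lifts. *)
Lemma Ab_iso (A B : Ab) (f : hom A B) (g : B -> A) :
  cancel f g -> cancel g f -> is_iso f.
Proof.
move=> fK gK.
have gB : zmod_morphism g by exact: can2_zmod_morphism fK gK.
pose gM := GRing.isZmodMorphism.Build B A g gB.
pose ga : {additive B -> A} := HB.pack g gM.
by exists ga; split; apply: additive_eq => x; [exact: fK|exact: gK].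
Qed.

(** * Parity of integers *)

Lemma mod2_double (k : int) : (k *+ 2)%:~R = 0 :> 'Z_2.
Proof.
have two0 : 2%:R = 0 :> 'Z_2 by exact/val_inj.
by rewrite rmorphMn /= -mulr_natr two0 mulr0.
Qed.

Lemma mod2_eq0 (n : int) : n%:~R = 0 :> 'Z_2 -> exists k : int, n = k *+ 2.
Proof.
rewrite {1}(divz_eq n 2) mulr_natr rmorphD /= mod2_double add0r => e.
exists (n %/ 2)%Z; rewrite [LHS](divz_eq n 2) mulr_natr.
have := ltz_pmod n (isT : 0 < 2 :> int).
have := modz_ge0 n (isT : 2 != 0 :> int).
by case: (n %% 2)%Z e => [[|[|]]|] //; rewrite addr0.
Qed.

Lemma Z2_lift (x : 'Z_2) : (x : nat)%:Z%:~R = x.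
Proof. by rewrite -pmulrn natr_Zp. Qed.

(** * Symmetric form parameters as pullbacks; full faithfulness of [v_functor] *)

Section SymmetricPullback.
Variables (Q : form_parameter) (sQ : symmetric_fp Q).

Lemma symmetric_hp (n : int) : fp_h Q (fp_p Q n) = n *+ 2.
Proof. by rewrite symmetryP sQ mulr2n mulrDl mul1r. Qed.

Lemma symmetric_fp_inj (x y : Qe Q) :
  lin_pi Q x = lin_pi Q y -> fp_h Q x = fp_h Q y -> x = y.
Proof.
move=> /lin_pi_eq[n e] hxy; apply/eqP; rewrite -subr_eq0 e.
have : fp_h Q (x - y) = 0 by rewrite raddfB hxy subrr.
by rewrite e symmetric_hp => /eqP; rewrite mulrn_eq0 /= => /eqP->; rewrite raddf0.
Qed.

Lemma symmetric_fp_surj (y : linearisation Q) (n : int) :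
  v_map sQ y = n%:~R -> exists q, lin_pi Q q = y /\ fp_h Q q = n.
Proof.
rewrite -[y]lin_pi_surj v_map_pi => e.
have [k kE] : exists k : int, n - fp_h Q (repr y) = k *+ 2.
  by apply: mod2_eq0; rewrite rmorphB /= e subrr.
(* Adding [p k] keeps the class and raises [h] by [2 k], exactly the defect. *)
exists (repr y + fp_p Q k); split; last by rewrite raddfD symmetric_hp -kE addrC subrK.
by apply/lin_pi_eq; exists k; rewrite addrAC subrr add0r.
Qed.
End SymmetricPullback.

Lemma v_faithful (P Q : FP_plus) (f g : hom P Q) :
  fmap v_functor f = fmap v_functor g -> f = g.
Proof.
move=> /(congr1 (@proj1_sig _ _)) /= fg; apply: fp_morphism_eq => x.
apply: (symmetric_fp_inj (proj2_sig Q)); last by rewrite -!fp_map_h.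
by rewrite -!lin_map_pi fg.
Qed.

(** The preimage sends [x] to the unique element with class [g [x]] and [h]-value [h x]. Uniqueness
    ([symmetric_fp_inj]) makes this choice additive and compatible with [p]. *)
Lemma v_full (P Q : FP_plus) (g : hom (v_functor P) (v_functor Q)) :
  exists f : hom P Q, fmap v_functor f = g.
Proof.
case: P Q g => [P sP] [Q sQ] [/= g vg].
(* The parity condition holds because [g] is a morphism over [Z2]. *)
have lift x : exists q, lin_pi Q q = g (lin_pi P x) /\ fp_h Q q = fp_h P x.
  apply: (symmetric_fp_surj (sQ := sQ)); rewrite -v_map_pi.
  by rewrite -[in RHS]vg.
pose a x := proj1_sig (cid (lift x)).
have a_pi x : lin_pi Q (a x) = g (lin_pi P x) := (proj2_sig (cid (lift x))).1.
have a_h x : fp_h Q (a x) = fp_h P x := (proj2_sig (cid (lift x))).2.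
have aB : zmod_morphism a.
  by move=> x y; apply: (symmetric_fp_inj sQ); rewrite !raddfB ?a_pi ?a_h !raddfB.
pose aM := GRing.isZmodMorphism.Build _ _ a aB.
pose aa : {additive Qe P -> Qe Q} := HB.pack a aM.
have pi_p R n : lin_pi R (fp_p R n) = 0.
  by rewrite -(raddf0 (lin_pi R)); apply/lin_pi_eq; exists n; rewrite subr0.
have ap n : fp_p Q n = aa (fp_p P n).
  apply: (symmetric_fp_inj sQ); first by rewrite a_pi !pi_p raddf0.
  by rewrite a_h !symmetric_hp.
have ah x : fp_h P x = fp_h Q (aa x) by rewrite a_h.
pose alpha : fp_morphism P Q := @FPMorphism P Q aa ah ap.
exists alpha; apply: eq_exist; apply: additive_eq => x.
change (lin_map alpha x = g x).
by rewrite -[x]lin_pi_surj lin_map_pi; exact: a_pi.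
Qed.

(** * The symmetric form parameter of a homomorphism to ['Z_2] *)

Section Pullback.
Variables (A : fgab) (v : {additive A -> 'Z_2}).

Definition pullback_pred (x : A * int) : bool := v x.1 == x.2%:~R.

Lemma pullback_zmod_closed : zmod_closed pullback_pred.
Proof.
split; first by rewrite unfold_in /pullback_pred /= raddf0.
move=> x y; rewrite !unfold_in /pullback_pred => /eqP vx /eqP vy /=.
by rewrite raddfB vx vy rmorphB.
Qed.

HB.instance Definition _ :=
  GRing.isZmodClosed.Build (A * int)%type pullback_pred pullback_zmod_closed.

Record pullback := Pullback {
  pullback_val : A * int;
  pullback_valP : pullback_val \in pullback_pred
}.

HB.instance Definition _ := [isSub for pullback_val].
HB.instance Definition _ := [Choice of pullback by <:].
HB.instance Definition _ := [SubChoice_isSubZmodule of pullback by <:].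

Lemma pullbackP (x : pullback) : v (val x).1 = (val x).2%:~R.
Proof. exact/eqP/(pullback_valP x). Qed.

Definition pullback_pair (a : A) (n : int) (e : v a = n%:~R) : pullback :=
  @Pullback (a, n) (introT eqP e).

Definition pullback_h (x : pullback) : int := (val x).2.

Lemma pullback_h_additive : zmod_morphism pullback_h.
Proof. by []. Qed.

HB.instance Definition _ :=
  GRing.isZmodMorphism.Build pullback int pullback_h pullback_h_additive.

Definition pullback_fst (x : pullback) : A := (val x).1.

Lemma pullback_fst_additive : zmod_morphism pullback_fst.
Proof. by []. Qed.

HB.instance Definition _ :=
  GRing.isZmodMorphism.Build pullback A pullback_fst pullback_fst_additive.

Lemma pullback_eq (x y : pullback) :
  pullback_fst x = pullback_fst y -> pullback_h x = pullback_h y -> x = y.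
Proof.
case: x y => [[a m] am] [[b n] bn]; rewrite /pullback_fst /pullback_h /=.
by move=> ab mn; apply: val_inj; rewrite /= ab mn.
Qed.

(** Generators are lifts of the generators of [A], together with [(0, 2)]: once the first coordinate
    is matched, the error in the second is even. *)
Lemma pullback_fg : finitely_generated pullback.
Proof.
have [n [g gP]] := fgabP A.
have two : v 0 = 2%:~R by rewrite raddf0 (mod2_double 1).
(* Index [0] carries [(0, 2)]; the others carry the lifted generators. *)
pose gens (i : 'I_n.+1) :=
  if unlift ord0 i is Some j then pullback_pair (esym (Z2_lift (v (g j))))
  else pullback_pair two.
exists n.+1, gens => x; have [c cE] := gP (val x).1.
pose y : pullback := \sum_(j < n) pullback_pair (esym (Z2_lift (v (g j)))) *~ c j.
have y1 : pullback_fst y = (val x).1.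
  by rewrite cE raddf_sum; apply: eq_bigr => j _; rewrite raddfMz.
have [k kE] : exists k : int, (val x).2 - (val y).2 = k *+ 2.
  by apply: mod2_eq0; rewrite rmorphB /= -!pullbackP [(val y).1]y1 subrr.
exists (fun i => if unlift ord0 i is Some j then c j else k).
rewrite big_ord_recl /gens unlift_none.
under eq_bigr => j _ do rewrite liftK.
rewrite -/y; apply: pullback_eq; rewrite raddfD raddfMz.
  by rewrite [X in _ + X]y1 mul0rz add0r.
by rewrite -[RHS]/(2 *~ k + (val y).2) -mulrzl intz mulr_natr -kE subrK.
Qed.

Lemma pullback_p_subproof (n : int) : v 0 = (n *+ 2)%:~R.
Proof. by rewrite raddf0 mod2_double. Qed.

(** The image is the whole kernel of [pullback_fst], as [(0, m)] lies in the pullback only for even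
    [m]; hence the linearisation recovers [A]. *)
Definition pullback_p (n : int) : pullback :=
  pullback_pair (pullback_p_subproof n).

Lemma pullback_p_additive : zmod_morphism pullback_p.
(* The first coordinate on the right is [0 - 0], so the [0] on the left is expanded to match. *)
Proof. by move=> m n; apply: val_inj; rewrite /= mulrnBl -[in LHS](subr0 0). Qed.

HB.instance Definition _ :=
  GRing.isZmodMorphism.Build int pullback pullback_p pullback_p_additive.

Lemma pullback_hph (x : pullback) :
  pullback_h (pullback_p (pullback_h x)) = pullback_h x *+ 2.
Proof. by []. Qed.

Lemma pullback_php (n : int) :
  pullback_p (pullback_h (pullback_p n)) = pullback_p n *+ 2.
Proof. by rewrite -raddfMn. Qed.

Definition pullback_fp : form_parameter :=
  @FormParameter (FGAb pullback_fg) pullback_h pullback_p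
    pullback_hph pullback_php.

Lemma pullback_symmetric : symmetric_fp pullback_fp.
Proof. by []. Qed.

Lemma pullback_fst_p (n : int) : pullback_fst (fp_p pullback_fp n) = 0.
Proof. by []. Qed.

Definition pullback_counit : {additive linearisation pullback_fp -> A} :=
  @lin_lift pullback_fp A pullback_fst pullback_fst_p.

Lemma pullback_counit_pi (x : pullback) :
  pullback_counit (lin_pi pullback_fp x) = (val x).1.
Proof. exact: lin_lift_pi. Qed.

(** Two integer lifts of [v a] differ by an even number, so the class does not depend on the lift
    chosen. *)
Definition pullback_inv (a : A) : linearisation pullback_fp :=
  lin_pi pullback_fp (pullback_pair (esym (Z2_lift (v a)))).

Lemma pullback_invK : cancel pullback_inv pullback_counit.
Proof. by move=> a; rewrite pullback_counit_pi. Qed.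

Lemma pullback_counitK : cancel pullback_counit pullback_inv.
Proof.
move=> x; rewrite -[x]lin_pi_surj pullback_counit_pi; apply/lin_pi_eq.
set q : pullback := repr x.
have [k kE] : exists k : int, ((v (val q).1 : nat)%:Z : int) - (val q).2 = k *+ 2.
  by apply: mod2_eq0; rewrite rmorphB /= Z2_lift pullbackP subrr.
(* The two representatives differ by [(0, 2 k)], which is [pullback_p k]. *)
by exists k; apply: val_inj; rewrite /= -kE; congr pair; exact: subrr.
Qed.

(** Makes the counit a morphism of the slice category. *)
Lemma pullback_v (x : linearisation pullback_fp) :
  v (pullback_counit x) = v_map pullback_symmetric x.
Proof.
by rewrite -[x]lin_pi_surj v_map_pi pullback_counit_pi pullbackP.
Qed.
End Pullback.

Lemma v_equivalence : is_equivalence v_functor.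
Proof.
pose G0 (d : slice Z2) : FP_plus :=
  exist symmetric_fp (pullback_fp (projT2 d)) (pullback_symmetric (projT2 d)).
have comm (d : slice Z2) :
    compose (projT2 d) (pullback_counit (projT2 d) : hom (linearisation _ : Ab) _)
    = projT2 (v_functor (G0 d)).
  by apply: additive_eq; exact: pullback_v.
pose counit (d : slice Z2) : hom (v_functor (G0 d)) d :=
  exist _ (pullback_counit (projT2 d)) (comm d).
apply: (fully_faithful_equivalence v_full v_faithful (counit := counit)) => d.
apply: slice_iso.
exact: Ab_iso (@pullback_counitK _ (projT2 d)) (@pullback_invK _ (projT2 d)).
Qed.

(** * Anti-symmetric form parameters and the coslice *)

Lemma antisymmetric_h0 (Q : form_parameter) (x : Qe Q) :
  antisymmetric_fp Q -> fp_h Q x = 0.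
Proof.
move=> aQ; have : fp_h Q x *+ 2 = 0 by rewrite -fp_hph symmetryP aQ subrr mul0r.
by move/eqP; rewrite mulrn_eq0 /= => /eqP.
Qed.

Lemma v'_faithful (P Q : FP_minus) (f g : hom P Q) :
  fmap v'_functor f = fmap v'_functor g -> f = g.
Proof.
move=> /(congr1 (@proj1_sig _ _)) /= fg; apply: fp_morphism_eq => x.
by rewrite fg.
Qed.

Lemma v'_full (P Q : FP_minus) (g : hom (v'_functor P) (v'_functor Q)) :
  exists f : hom P Q, fmap v'_functor f = g.
Proof.
case: P Q g => [P aP] [Q aQ] [/= g vg].
have gh x : fp_h P x = fp_h Q (g x) by rewrite !antisymmetric_h0.
have gp n : fp_p Q n = g (fp_p P n).
  (* Compatibility with [p] is the coslice condition at the class of [n]. *)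
  by rewrite -(v'_mapE aQ) -(v'_mapE aP) -[in LHS]vg.
by exists (FPMorphism gh gp); apply: eq_exist.
Qed.

Section Coslice.
Variables (A : fgab) (w : {additive 'Z_2 -> A}).

Definition coslice_p : {additive int -> A} := w \o mod2.
(** The only possible choice, by [antisymmetric_h0]. *)
Definition coslice_h : {additive A -> int} := \0.

Lemma coslice_hph (x : A) :
  coslice_h (coslice_p (coslice_h x)) = coslice_h x *+ 2.
Proof. by rewrite /= mul0rn. Qed.

Lemma coslice_php (n : int) :
  coslice_p (coslice_h (coslice_p n)) = coslice_p n *+ 2.
Proof. by rewrite -raddfMn /= raddf0 [mod2 _]mod2_double raddf0. Qed.

Definition coslice_fp : form_parameter := FormParameter coslice_hph coslice_php.

Lemma coslice_antisymmetric : antisymmetric_fp coslice_fp.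
Proof. by []. Qed.

Lemma coslice_v' (x : 'Z_2) : v'_map coslice_antisymmetric x = w x.
Proof. by rewrite -[x]Z2_lift v'_mapE. Qed.
End Coslice.

Lemma v'_equivalence : is_equivalence v'_functor.
Proof.
pose G0 (d : coslice Z2) : FP_minus :=
  exist antisymmetric_fp (coslice_fp (projT2 d)) (coslice_antisymmetric (projT2 d)).
have comm (d : coslice Z2) :
    compose (ident (projT1 d)) (projT2 (v'_functor (G0 d))) = projT2 d.
  by apply: additive_eq; exact: coslice_v'.
(* The construction keeps the underlying group, so the identity serves as counit. *)
pose counit (d : coslice Z2) : hom (v'_functor (G0 d)) d :=
  exist _ (ident (projT1 d)) (comm d).
apply: (fully_faithful_equivalence v'_full v'_faithful (counit := counit)) => d.
by apply: coslice_iso; apply: (@Ab_iso _ _ _ id).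
Qed.

Theorem theorem1p3 : is_equivalence v_functor /\ is_equivalence v'_functor.
Proof. by split; [exact: v_equivalence|exact: v'_equivalence]. Qed.
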